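(* Let $p$ be a prime, let $P \in \mathbb{Z}_p[x, y]$ satisfy $P(0, 0) = 0$ and $\frac{\partial P}{\partial y}(0, 0) \not\equiv 0 \bmod p$, and let $\hat{Q}$, $\mathcal{M}_{p^\alpha}$, $\lambda^{(\alpha)}_{r,0}$, $\mathrm{rep}_{p/\hat Q}$ be as in the context. Let $\alpha \geq 1$, $\beta \in \{1, 2, \dots, \alpha\}$, and $r \in \{0, 1, \dots, p-1\}$. Let $S^{(\beta)} \in \mathcal{M}_{p^\beta}$ and $S^{(\alpha)} \in \mathcal{M}_{p^\alpha}$ be such that the first $\beta$ digits of $\mathrm{rep}_{p/\hat{Q}}(S^{(\alpha)})$ agree with $\mathrm{rep}_{p/\hat{Q}}(S^{(\beta)})$. Then the first $\beta$ digits of $\mathrm{rep}_{p/\hat{Q}}(\lambda_{r, 0}^{(\alpha)}(S^{(\alpha)}))$ agree with $\mathrm{rep}_{p/\hat{Q}}(\lambda_{r, 0}^{(\beta)}(S^{(\beta)}))$.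
   Context: For $\gamma \geq 1$ write $\mathcal{R}_{p^\gamma} = \mathbb{Z}/p^\gamma\mathbb{Z}$. Let $\hat{Q} \in \mathbb{Z}_p[x, y, y^{-1}]$ be a lift of $P/y \bmod p$ having the same monomial support as $P/y \bmod p$. Cartier operators: $\Lambda_{r, 0}$ is the linear operator on Laurent polynomials with $\Lambda_{r, 0}(x^m y^n) = x^{(m - r)/p} y^{n/p}$ if $m \equiv r$ and $n \equiv 0 \bmod p$, and $0$ otherwise. For $\gamma \geq 1$ and $S \in \mathcal{R}_{p^\gamma}[x, y, y^{-1}]$ put $\lambda^{(\gamma)}_{r, 0}(S) := \Lambda_{r, 0}\big(S\, (\hat Q \bmod p^\gamma)^{p^\gamma - p^{\gamma - 1}}\big)$. States: $S_0^{(\gamma)} := \big(y \frac{\partial P}{\partial y} (P/y)^{p^{\gamma - 1} - 1} \bmod p^\gamma\big)$, and $\mathcal{M}_{p^\gamma}$ is the smallest subset of $\mathcal{R}_{p^\gamma}[x, y, y^{-1}]$ that contains $S_0^{(\gamma)}$ and is closed under $\lambda^{(\gamma)}_{r, 0}$ for all $r \in \{0, \dots, p-1\}$. Representations: let $D = \{0, 1, \dots, p-1\}$, viewed as a subset of each $\mathcal{R}_{p^\gamma}$, and let $D[x, y, y^{-1}]$ be the set of Laurent polynomials with all coefficients in $D$. Every $S \in \mathcal{M}_{p^\gamma}$ can be written uniquely as $S = \sum_{k = 0}^{\gamma - 1} T_k\, p^k (\hat Q \bmod p^\gamma)^{p^{\gamma - 1} - 1 - k}$ with all $T_k \in D[x,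 y, y^{-1}]$; then $\mathrm{rep}_{p/\hat Q}(S) := (T_{\gamma - 1}, \dots, T_1, T_0)$, and $T_k$ is the $k$th digit. The ''first $\beta$ digits'' are $T_0, T_1, \dots, T_{\beta - 1}$. *)

(* Defs.v *)
From HB Require Import structures.
From mathcomp Require Import all_boot all_order all_algebra.
From mathcomp Require Import boolp classical_sets.
From mathcomp Require Import finmap monalg.

Set Implicit Arguments.
Unset Strict Implicit.
Unset Printing Implicit Defensive.

Import GRing.Theory.

Local Open Scope ring_scope.

(* The ring Z_p as the inverse limit of the Z/p^n: x n is the representative  *)
(* of x mod p^n in {0, ..., p^n - 1}.                                          *)
Section Padic.
Context (p : nat).

Definition padic_coherent : pred (nat -> int) :=
  fun x => `[< forall n, x n = (x n.+1 %% (p ^ n)%N)%Z >].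

(* The primality proof only serves to make 1 != 0. *)
Record padic (p_pr : prime p) : predArgType := Padic {
  padic_val :> nat -> int;
  padicP : padic_coherent padic_val }.

Context (p_pr : prime p).
Notation Zp := (padic p_pr).

HB.instance Definition _ := [isSub of Zp for @padic_val p_pr].
HB.instance Definition _ := [Choice of Zp by <:].

Lemma padic_mod (x : Zp) n : (x n %% (p ^ n)%N)%Z = x n.
Proof. by rewrite (asboolW (padicP x) n) modz_mod. Qed.

Lemma padic_ext (x y : Zp) : (forall n, x n = y n) -> x = y.
Proof. by move=> xy; apply/val_inj/funext. Qed.

Lemma padic_coherent_mod (u : nat -> int) :
    (forall n, u n = u n.+1 %[mod (p ^ n)%N])%Z ->
  padic_coherent (fun n => (u n %% (p ^ n)%N)%Z).
Proof.
move=> uP; apply/asboolP => n; rewrite uP; apply/eqP.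
rewrite eqz_mod_dvd {1}[u n.+1](divz_eq _ (p ^ n.+1)%N) addrK.
by apply: dvdz_mull; rewrite expnS PoszM dvdz_mull.
Qed.

Lemma padic_succ (x : Zp) n : (x n = x n.+1 %[mod (p ^ n)%N])%Z.
Proof. by rewrite (asboolW (padicP x) n) modz_mod. Qed.

Definition padic_int (m : int) : Zp :=
  Padic p_pr (padic_coherent_mod (u := fun=> m) (fun=> erefl)).

Lemma padic_opp_subproof (x : Zp) :
  (forall n, - x n = - x n.+1 %[mod (p ^ n)%N])%Z.
Proof. by move=> n; rewrite -modzNm padic_succ modzNm. Qed.

Definition padic_opp (x : Zp) : Zp :=
  Padic p_pr (padic_coherent_mod (@padic_opp_subproof x)).

Lemma padic_add_subproof (x y : Zp) :
  (forall n, x n + y n = x n.+1 + y n.+1 %[mod (p ^ n)%N])%Z.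
Proof. by move=> n; rewrite -modzDm !padic_succ modzDm. Qed.

Definition padic_add (x y : Zp) : Zp :=
  Padic p_pr (padic_coherent_mod (@padic_add_subproof x y)).

Lemma padic_mul_subproof (x y : Zp) :
  (forall n, x n * y n = x n.+1 * y n.+1 %[mod (p ^ n)%N])%Z.
Proof. by move=> n; rewrite -modzMm !padic_succ modzMm. Qed.

Definition padic_mul (x y : Zp) : Zp :=
  Padic p_pr (padic_coherent_mod (@padic_mul_subproof x y)).

Lemma padic_addA : associative padic_add.
Proof. by move=> x y z; apply: padic_ext => n /=; rewrite modzDmr modzDml addrA. Qed.

Lemma padic_addC : commutative padic_add.
Proof. by move=> x y; apply: padic_ext => n /=; rewrite addrC. Qed.

Lemma padic_add0 : left_id (padic_int 0) padic_add.
Proof. by move=> x; apply: padic_ext => n /=; rewrite modzDml add0r padic_mod. Qed.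

Lemma padic_addN : left_inverse (padic_int 0) padic_opp padic_add.
Proof. by move=> x; apply: padic_ext => n /=; rewrite modzDml addNr. Qed.

HB.instance Definition _ :=
  GRing.isZmodule.Build Zp padic_addA padic_addC padic_add0 padic_addN.

Lemma padic_mulA : associative padic_mul.
Proof. by move=> x y z; apply: padic_ext => n /=; rewrite modzMmr modzMml mulrA. Qed.

Lemma padic_mulC : commutative padic_mul.
Proof. by move=> x y; apply: padic_ext => n /=; rewrite mulrC. Qed.

Lemma padic_mul1 : left_id (padic_int 1) padic_mul.
Proof. by move=> x; apply: padic_ext => n /=; rewrite modzMml mul1r padic_mod. Qed.

Lemma padic_mulDl : left_distributive padic_mul padic_add.
Proof.
by move=> x y z; apply: padic_ext => n /=; rewrite modzMml modzDm mulrDl.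
Qed.

Lemma padic_1_neq0 : padic_int 1 != 0.
Proof.
apply/eqP => /(congr1 (fun x : Zp => x 1%N)) /=.
rewrite expn1 mod0z modz_nat => -[].
by rewrite modn_small // prime_gt1.
Qed.

HB.instance Definition _ :=
  GRing.Zmodule_isComNzRing.Build Zp
    padic_mulA padic_mulC padic_mul1 padic_mulDl padic_1_neq0.

(* For g = 0 this is junk, since 'Z_(p ^ 0) = 'Z_1 is Z/2. *)
Definition padic_red (g : nat) (x : Zp) : 'Z_(p ^ g) := (x g)%:~R.

End Padic.

(* The ring R[x, y, y^-1]. The coefficient S@_(m, n) is that of x^m y^n, and  *)
(* msupp S is the monomial support of S. The ring structure of {malg R[K]}    *)
(* is only available for monoids K without nontrivial units, hence the alias. *)
Definition laurent (R : nzRingType) : Type := {malg R[(nat * int)%type]}.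

Section Laurent.
Context (R : nzRingType).
Notation L := (laurent R).
Notation K := (nat * int)%type.

HB.instance Definition _ := GRing.Lmodule.on L.

Definition lmonom (m : nat) (n : int) : L := mkmalgU (m, n) 1.

Definition laurent_mul (S T : L) : L :=
  \sum_(k <- msupp S) \sum_(l <- msupp T) mkmalgU (k + l) (S@_k * T@_l).

Lemma laurent_mulw (d1 d2 : {fset K}) (S T : L) :
    (msupp S `<=` d1)%fset -> (msupp T `<=` d2)%fset ->
  laurent_mul S T =
    \sum_(k <- d1) \sum_(l <- d2) mkmalgU (k + l) (S@_k * T@_l).
Proof.
move=> le1 le2; rewrite /laurent_mul (big_fset_incl _ le1) /=.
  apply/eq_bigr => k _; apply/big_fset_incl => // l _ /mcoeff_outdom ->.
  by rewrite mulr0 monalgU0.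
move=> k _ /mcoeff_outdom Sk.
by rewrite big1 // => l _; rewrite Sk mul0r monalgU0.
Qed.

Lemma laurent_mulDl : left_distributive laurent_mul +%R.
Proof.
move=> S1 S2 T.
rewrite [in RHS](laurent_mulw (fsubsetUl _ (msupp S2)) (fsubset_refl _)).
rewrite [in RHS](laurent_mulw (fsubsetUr (msupp S1) _) (fsubset_refl _)).
rewrite (laurent_mulw (msuppD_le _ _) (fsubset_refl _)).
rewrite -big_split /=; apply/eq_bigr => k _.
rewrite -big_split /=; apply/eq_bigr => l _.
by rewrite mcoeffD mulrDl monalgUD.
Qed.

Lemma laurent_mulDr : right_distributive laurent_mul +%R.
Proof.
move=> T S1 S2.
rewrite [in RHS](laurent_mulw (fsubset_refl _) (fsubsetUl _ (msupp S2))).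
rewrite [in RHS](laurent_mulw (fsubset_refl _) (fsubsetUr (msupp S1) _)).
rewrite (laurent_mulw (fsubset_refl _) (msuppD_le _ _)).
rewrite -big_split /=; apply/eq_bigr => k _.
rewrite -big_split /=; apply/eq_bigr => l _.
by rewrite mcoeffD mulrDr monalgUD.
Qed.

Lemma laurent_mul0l : left_zero 0 laurent_mul.
Proof. by move=> S; rewrite /laurent_mul msupp0 big_seq_fset0. Qed.

Lemma laurent_mul0r : right_zero 0 laurent_mul.
Proof.
by move=> S; rewrite /laurent_mul big1 // => k _; rewrite msupp0 big_seq_fset0.
Qed.

Lemma laurent_mulUU (k l : K) (c d : R) :
  laurent_mul (mkmalgU k c) (mkmalgU l d) = mkmalgU (k + l) (c * d).
Proof. by rewrite (laurent_mulw msuppU_le msuppU_le) !big_seq_fset1 !mcoeffUU. Qed.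

Lemma laurent_mulE1l (S T : L) :
  laurent_mul S T = \sum_(k <- msupp S) laurent_mul (mkmalgU k S@_k) T.
Proof.
rewrite {1}[S]monalgE.
exact: (big_morph (laurent_mul^~ T) (fun _ _ => laurent_mulDl _ _ _)
  (laurent_mul0l _)).
Qed.

Lemma laurent_mulE1r (S T : L) :
  laurent_mul S T = \sum_(k <- msupp T) laurent_mul S (mkmalgU k T@_k).
Proof.
rewrite {1}[T]monalgE.
exact: (big_morph (laurent_mul S) (fun _ _ => laurent_mulDr _ _ _)
  (laurent_mul0r _)).
Qed.

Lemma laurent_mul1l : left_id (lmonom 0 0) laurent_mul.
Proof.
move=> S; rewrite laurent_mulE1r [RHS]monalgE; apply/eq_bigr => k _.
by rewrite laurent_mulUU mul1r add0r.
Qed.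

Lemma laurent_mul1r : right_id (lmonom 0 0) laurent_mul.
Proof.
move=> S; rewrite laurent_mulE1l [RHS]monalgE; apply/eq_bigr => k _.
by rewrite laurent_mulUU mulr1 addr0.
Qed.

Lemma laurent_mulA : associative laurent_mul.
Proof.
move=> S T U.
rewrite [RHS](big_morph (laurent_mul^~ U) (fun _ _ => laurent_mulDl _ _ _)
  (laurent_mul0l _)) laurent_mulE1l; apply/eq_bigr => k _.
rewrite [LHS](big_morph (laurent_mul _) (fun _ _ => laurent_mulDr _ _ _)
  (laurent_mul0r _)).
rewrite [RHS](big_morph (laurent_mul^~ U) (fun _ _ => laurent_mulDl _ _ _)
  (laurent_mul0l _)); apply/eq_bigr => l _.
rewrite [LHS](big_morph (laurent_mul _) (fun _ _ => laurent_mulDr _ _ _)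
  (laurent_mul0r _)) laurent_mulE1r; apply/eq_bigr => m _.
by rewrite !laurent_mulUU mulrA addrA.
Qed.

Lemma laurent_1_neq0 : lmonom 0 0 != 0.
Proof.
by apply/eqP => /malgP /(_ (0%N, 0)) /eqP; rewrite mcoeffUU mcoeff0 oner_eq0.
Qed.

HB.instance Definition _ := GRing.Zmodule_isNzRing.Build L
  laurent_mulA laurent_mul1l laurent_mul1r laurent_mulDl laurent_mulDr
  laurent_1_neq0.

End Laurent.

Lemma laurent_mulC (R : comNzRingType) : commutative (@laurent_mul R).
Proof.
move=> S T; rewrite /laurent_mul exchange_big /=.
by apply/eq_bigr => l _; apply/eq_bigr => k _; rewrite mulrC addrC.
Qed.

HB.instance Definition _ (R : comNzRingType) :=
  GRing.PzRing_hasCommutativeMul.Build (laurent R) (@laurent_mulC R).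

Definition lmap (R R' : nzRingType) (f : R -> R') (S : laurent R) : laurent R' :=
  [malg k in msupp S => f S@_k].

(* P : {poly {poly R}} stands for an element of R[x, y]: the outer variable   *)
(* is y, so that P`_j`_i is the coefficient of x^i y^j and P^`() = dP/dy.     *)
Definition laurent_of_poly (R : nzRingType) (P : {poly {poly R}}) : laurent R :=
  \sum_(j < size P) \sum_(i < size P`_j) P`_j`_i *: lmonom R i j.

(* Meant for r < p, where k.1 = r mod p forces r <= k.1. *)
Definition cartier (p : nat) (R : nzRingType) (r : nat) (S : laurent R) :
    laurent R :=
  \sum_(k <- msupp S | (k.1 == r %[mod p])%N && (p %| k.2)%Z)
    S@_k *: lmonom R ((k.1 - r) %/ p)%N (k.2 %/ p)%Z.

Section States.
Context (p : nat) (p_pr : prime p).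
Notation Zp := (padic p_pr).

Definition lred (g : nat) (S : laurent Zp) : laurent 'Z_(p ^ g) :=
  lmap (@padic_red p p_pr g) S.

Definition div_y (P : {poly {poly Zp}}) : laurent Zp :=
  laurent_of_poly P * lmonom Zp 0 (- 1).

Definition is_lift (Q : laurent Zp) (P : {poly {poly Zp}}) : Prop :=
  lred 1 Q = lred 1 (div_y P) /\ msupp Q = msupp (lred 1 (div_y P)).

Definition lambda (Q : laurent Zp) (g r : nat) (S : laurent 'Z_(p ^ g)) :
    laurent 'Z_(p ^ g) :=
  cartier p r (S * lred g Q ^+ (p ^ g - p ^ (g - 1))).

Definition init_state (P : {poly {poly Zp}}) (g : nat) : laurent 'Z_(p ^ g) :=
  lred g (lmonom Zp 0 1 * laurent_of_poly P^`()
          * div_y P ^+ (p ^ (g - 1) - 1)).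

Inductive states (P : {poly {poly Zp}}) (Q : laurent Zp) (g : nat) :
    laurent 'Z_(p ^ g) -> Prop :=
| states_init : states P Q (init_state P g)
| states_lambda (r : 'I_p) S : states P Q S -> states P Q (lambda Q r S).

(* The digit set D is taken in int, so that digits of representations modulo  *)
(* different powers of p can be compared.                                     *)
Definition digit_poly (T : laurent int) : Prop :=
  forall k, (0 <= T@_k < p%:Z)%R.

Definition is_rep (Q : laurent Zp) (g : nat) (S : laurent 'Z_(p ^ g))
    (T : 'I_g -> laurent int) : Prop :=
  (forall k, digit_poly (T k)) /\
  S = \sum_(k < g) lmap intr (T k) * p%:R ^+ k
                   * lred g Q ^+ (p ^ (g - 1) - 1 - k).

(* rep Q g S k is the digit T_k. The default value plays no role for the      *)
(* states of P and a lift Q of P / y modulo p when dP/dy(0, 0) is nonzero     *)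
(* modulo p: these have exactly one representation.                           *)
Definition rep (Q : laurent Zp) (g : nat) (S : laurent 'Z_(p ^ g)) :
    'I_g -> laurent int :=
  xget (fun=> 0) [set T | is_rep Q S T]%classic.

End States.

Arguments states {p p_pr} P Q g _.
Arguments lambda {p p_pr} Q g r S.
Arguments rep {p p_pr} Q g S _.

(* Main.v *)
From HB Require Import structures.
Require Import Defs.
From mathcomp Require Import all_boot all_order all_algebra.
From mathcomp Require Import boolp classical_sets finmap monalg ring zify.

(* Write S = sum_k T_k p^k Q^(p^(g-1)-1-k) modulo p^g. Since Q is regular      *)
(* modulo every p^g, the first beta digits of S_alpha agree with those of      *)
(* S_beta if and only if S_alpha = Q^(p^(alpha-1) - p^(beta-1)) S_beta modulo  *)
(* p^beta. This relation is preserved by lambda: with F = Q(x^p, y^p) one has  *)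
(* Q^p = F mod p, hence Q^(p^beta) = F^(p^(beta-1)) mod p^beta, so the surplus *)
(* power Q^(p^alpha - p^beta) equals F^(p^(alpha-1) - p^(beta-1)) and comes    *)
(* out of the Cartier operator as Q^(p^(alpha-1) - p^(beta-1)). Existence of   *)
(* the digits of states follows from expanding powers of Q^p = F + p E in the  *)
(* same way, and carrying.                                                     *)

Set Implicit Arguments.
Unset Strict Implicit.
Unset Printing Implicit Defensive.

Import Order.TTheory GRing.Theory Num.Theory.

Local Open Scope ring_scope.

(** * Laurent polynomials *)

(** Put F = Q(x^p, y^p) and m = p^(g-1) - 1. Digits are never computed: their agreement is turned
    into a single congruence, and the congruence is transported. Existence: every state is a
    combination of the p^k Q^(m-k) with k < g ([init_state_span], [lambda_span]), and carrying makes
    the coefficients digits ([padic_span_expansion]). Uniqueness ([expansion_unique]) comes from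
    cancelling powers of Q, which is regular because its least monomial has a unit coefficient
    ([lift_lreg]). Reducing modulo p^beta leaves the first beta digits, up to a fixed power of Q
    ([truncate_rep]), and the relation so obtained between the two levels survives lambda
    ([lambda_truncate]). Both statements on lambda rest on Q^p = F mod p ([lred_expp_cong]) and on
    the fact that a factor F^n leaves the Cartier operator as Q^n ([cartier_mul_subst_exp]). *)

Lemma mcoeff_bigsum (R : nzRingType) I (s : seq I) (F : I -> laurent R) k :
  (\sum_(i <- s) F i)@_k = \sum_(i <- s) (F i)@_k.
Proof. exact: raddf_sum. Qed.

Lemma mcoeffM (R : nzRingType) (S T : laurent R) b :
  (S * T)@_b =
    \sum_(k <- msupp S) \sum_(l <- msupp T) (S@_k * T@_l) *+ (k + l == b).
Proof.
rewrite -[S * T]/(laurent_mul S T) /laurent_mul raddf_sum.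
apply: eq_bigr => k _; rewrite raddf_sum; apply: eq_bigr => l _.
exact: mcoeffU.
Qed.

Lemma monalgU_mul (R : nzRingType) (k l : nat * int) (c d : R) :
  (mkmalgU k c : laurent R) * mkmalgU l d = mkmalgU (k + l) (c * d).
Proof. exact: laurent_mulUU. Qed.

Lemma monalgU_exp (R : comNzRingType) (k : nat * int) (c : R) n :
  (mkmalgU k c : laurent R) ^+ n = mkmalgU (k *+ n) (c ^+ n).
Proof.
elim: n => [|n IHn]; first by rewrite !expr0 mulr0n.
by rewrite !exprS IHn monalgU_mul mulrS.
Qed.

Lemma mcoeffMnat (R : nzRingType) (S : laurent R) n k :
  (n%:R * S)@_k = n%:R * S@_k.
Proof. by rewrite mulr_natl mcoeffMn mulr_natl. Qed.

Lemma mcoeff_sum (R : nzRingType) (S : laurent R) k :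
  S@_k = \sum_(l <- msupp S) S@_l *+ (l == k).
Proof.
rewrite [in LHS](monalgE S) mcoeff_bigsum; apply: eq_bigr => l _; exact: mcoeffU.
Qed.

Lemma mcoeff_lmonomM (R : nzRingType) (S : laurent R) i (j n : int) :
  (S * lmonom R 0 j)@_(i, n) = S@_(i, n - j).
Proof.
rewrite {1}[S]monalgE mulr_suml mcoeff_bigsum [RHS]mcoeff_sum.
apply: eq_bigr => -[a b] _; rewrite monalgU_mul mcoeffU mulr1.
congr (_ *+ nat_of_bool _); rewrite !xpair_eqE /= addr0.
by rewrite (eq_sym b) subr_eq (eq_sym _ n).
Qed.

(* (0, 0) is the lexicographically least monomial of Q; it multiplies the least *)
(* monomial of A into one that no other product reaches.                        *)
Lemma laurent_unit0_lreg (R : comUnitRingType) (Q : laurent R) :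
    Q@_(0%N, 0) \is a GRing.unit ->
    (forall n : int, n < 0 -> Q@_(0%N, n) = 0) ->
  GRing.lreg Q.
Proof.
move=> Q0 Qneg; apply: mulrI0_lreg => A QA; apply/eqP/negPn/negP => An0.
have /fset0Pn[k0 k0A] : msupp A != fset0.
  apply: contra_neq An0 => A0.
  by apply/malgP => k; rewrite mcoeff0 mcoeff_outdom // A0 in_fset0.
(* The type [*l] carries the lexicographic total order, in which [b] is taken minimal. *)
pose F (k : msupp A) : (nat *l int)%type := fsval k.
case: (@arg_minP _ _ _ [` k0A]%fset xpredT F) => // b _ bmin.
have: (Q * A)@_(fsval b) = Q@_(0%N, 0) * A@_(fsval b).
  rewrite mcoeffM (mcoeff_sum Q) (mcoeff_sum A) mulr_suml.
  apply: eq_big_seq => k kQ; rewrite mulr_sumr; apply: eq_big_seq => l lA.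
  rewrite mulrnAr mulrnAl -mulrnA mulnb; congr (_ *+ nat_of_bool _).
  apply/eqP/andP => [|[/eqP-> /eqP->]]; last by rewrite add0r.
  have := bmin [` lA]%fset isT; rewrite /F /=.
  case: (fsval b) => b1 b2; case: l {lA} => l1 l2; case: k kQ => k1 k2 kQ.
  rewrite lexi_pair /= => /andP[le1 le2] [e1 e2].
  have k2ge : k1 = 0%N -> 0 <= k2.
    move=> k1E; rewrite leNgt; apply/negP => /Qneg; rewrite -k1E => /eqP.
    by rewrite mcoeff_eq0 kQ.
  rewrite leEnat in le1 le2.
  have k10 : k1 = 0%N by move: le1; rewrite -e1 /GRing.add /=; lia.
  move: le1 le2 e2 (k2ge k10); rewrite -e1 k10 add0r leqnn /= => _ le2 e2 k2p.
  have k20 : k2 = 0 by lia.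
  by rewrite -e2 k20 add0r !eqxx.
rewrite QA mcoeff0 -{1}(mulr0 Q@_(0%N, 0)) => /(mulrI Q0)/esym/eqP.
by rewrite mcoeff_eq0 (fsvalP b).
Qed.

Lemma lmapE (R R' : nzRingType) (f : R -> R') (S : laurent R) k :
  f 0 = 0 -> (lmap f S)@_k = f S@_k.
Proof.
by move=> f0; rewrite /lmap mcoeffE; case: ifPn => // /mcoeff_outdom ->.
Qed.

Lemma lmapU (R R' : nzRingType) (f : R -> R') k c :
  f 0 = 0 -> lmap f (mkmalgU k c) = mkmalgU k (f c).
Proof.
move=> f0; apply/malgP => l; rewrite lmapE // !mcoeffU.
by case: eqP; rewrite ?mulr1n ?mulr0n.
Qed.

Lemma lmap_comp (R R' R'' : nzRingType) (f : R -> R') (g : R' -> R'')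
    (h : R -> R'') (S : laurent R) :
    f 0 = 0 -> g 0 = 0 -> (forall c, g (f c) = h c) ->
  lmap g (lmap f S) = lmap h S.
Proof. by move=> f0 g0 fg; apply/malgP => k; rewrite !lmapE // -fg // f0. Qed.

Lemma lmap_is_zmod_morphism (R R' : nzRingType) (f : {rmorphism R -> R'}) :
  zmod_morphism (lmap f).
Proof.
move=> S T; apply/malgP => k.
by rewrite !(mcoeffB, lmapE, rmorph0, rmorphB).
Qed.

HB.instance Definition _ (R R' : nzRingType) (f : {rmorphism R -> R'}) :=
  GRing.isZmodMorphism.Build (laurent R) (laurent R') (lmap f)
    (lmap_is_zmod_morphism f).

Lemma lmap_sum (R R' : nzRingType) (f : {rmorphism R -> R'}) I (s : seq I)
    (F : I -> laurent R) :
  lmap f (\sum_(i <- s) F i) = \sum_(i <- s) lmap f (F i).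
Proof. exact: raddf_sum. Qed.

Lemma lmap_is_monoid_morphism (R R' : nzRingType) (f : {rmorphism R -> R'}) :
  monoid_morphism (lmap f).
Proof.
split=> [|S T]; first by rewrite lmapU ?rmorph0 // rmorph1.
rewrite {1}[S]monalgE mulr_suml lmap_sum.
rewrite [in RHS](monalgE S) lmap_sum mulr_suml.
apply: eq_bigr => k _.
rewrite {1}[T]monalgE mulr_sumr lmap_sum.
rewrite [in RHS](monalgE T) lmap_sum mulr_sumr.
apply: eq_bigr => l _.
by rewrite monalgU_mul !lmapU ?rmorph0 // monalgU_mul rmorphM.
Qed.

HB.instance Definition _ (R R' : nzRingType) (f : {rmorphism R -> R'}) :=
  GRing.isMonoidMorphism.Build (laurent R) (laurent R') (lmap f)
    (lmap_is_monoid_morphism f).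

(** * Cartier operators *)

(** Exactly one monomial is sent to (m, n). The bound r < p forces r <= k.1, so the truncated
    subtraction is exact. *)
Lemma cartier_index p r (k : nat * int) m n : (r < p)%N ->
  [&& (k.1 == r %[mod p])%N, (p %| k.2)%Z &
      (((k.1 - r) %/ p)%N, (k.2 %/ p)%Z) == (m, n)]
  = (k == ((m * p + r)%N, n * p%:Z)).
Proof.
move=> rp; case: k => a b /=; rewrite !xpair_eqE /=.
have p_gt0 : (0 < p)%N by apply: leq_ltn_trans rp.
apply/and3P/andP => [[amod bmod /andP[/eqP <- /eqP <-]]|[/eqP -> /eqP ->]].
  split; last by rewrite divzK.
  have ra : (r <= a)%N.
    by rewrite -(modn_small rp) -(eqP amod) leq_mod.
  by rewrite divnK ?subnK // -eqn_mod_dvd.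
rewrite modnMDl eqxx dvdz_mull // addnK mulnK // mulzK ?eqxx //.
by rewrite eqz_nat -lt0n.
Qed.

Lemma mcoeff_cartier p (R : nzRingType) r (S : laurent R) m n : (r < p)%N ->
  (cartier p r S)@_(m, n) = S@_((m * p + r)%N, n * p%:Z).
Proof.
move=> rp; rewrite /cartier big_mkcond mcoeff_bigsum mcoeff_sum.
apply: eq_bigr => k _; rewrite -cartier_index // andbA.
case: (_ && (p %| k.2)%Z) => /=; last by rewrite mcoeff0 mulr0n.
by rewrite mcoeffZ mcoeffU mulr_natr.
Qed.

Lemma cartierU p (R : nzRingType) r k (c : R) : (r < p)%N ->
  cartier p r (mkmalgU k c) =
    if (k.1 == r %[mod p])%N && (p %| k.2)%Z
    then mkmalgU (((k.1 - r) %/ p)%N, (k.2 %/ p)%Z) c else 0.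
Proof.
move=> rp; apply/malgP => -[m n]; rewrite mcoeff_cartier // mcoeffU.
rewrite -cartier_index // andbA.
by case: ifP => _; rewrite ?mcoeffU ?mcoeff0.
Qed.

Lemma cartier_lmap p (R R' : nzRingType) (f : {rmorphism R -> R'}) r S :
  (r < p)%N -> lmap f (cartier p r S) = cartier p r (lmap f S).
Proof.
move=> rp; apply/malgP => -[m n].
by rewrite lmapE ?rmorph0 // !mcoeff_cartier // lmapE ?rmorph0.
Qed.

Lemma cartier_sum p (R : nzRingType) r I (s : seq I) (F : I -> laurent R) :
  (r < p)%N ->
  cartier p r (\sum_(i <- s) F i) = \sum_(i <- s) cartier p r (F i).
Proof.
move=> rp; apply/malgP => -[m n]; rewrite mcoeff_cartier // !mcoeff_bigsum.
by apply: eq_bigr => i _; rewrite mcoeff_cartier.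
Qed.

(** This is S(x^p, y^p). *)
Definition subst_pow p (R : nzRingType) (S : laurent R) : laurent R :=
  \sum_(k <- msupp S) mkmalgU (k *+ p) S@_k.

Lemma pair_mulrn (k : nat * int) n : k *+ n = ((k.1 * n)%N, k.2 * n%:Z).
Proof.
elim: n => [|n IHn]; first by rewrite mulr0n muln0 mulr0.
by rewrite mulrS IHn mulnS intS mulrDr mulr1.
Qed.

(** Multiplying by a monomial in x^p and y^p keeps the exponents in their classes modulo p and
    shifts their quotients by those of the monomial of B. *)
Lemma cartier_mul_subst p (R : comNzRingType) r (A B : laurent R) :
  (r < p)%N -> cartier p r (A * subst_pow p B) = cartier p r A * B.
Proof.
move=> rp; have p_gt0 : (0 < p)%N by apply: leq_ltn_trans rp.
rewrite /subst_pow mulr_sumr cartier_sum // [X in _ * X]monalgE mulr_sumr.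
apply: eq_bigr => l _; rewrite [A]monalgE mulr_suml !cartier_sum // mulr_suml.
apply: eq_bigr => k _; rewrite monalgU_mul !cartierU // pair_mulrn.
have -> : k + ((l.1 * p)%N, l.2 * p%:Z) = ((k.1 + l.1 * p)%N, k.2 + l.2 * p%:Z).
  by [].
rewrite /= [in X in if X then _ else _]addnC modnMDl rpredDr ?dvdz_mull //.
case: ifP => [/andP[kmod kdvd]|_]; last by rewrite mul0r.
rewrite monalgU_mul; congr mkmalgU.
have rk : (r <= k.1)%N by rewrite -(modn_small rp) -(eqP kmod) leq_mod.
rewrite divzDl // mulzK ?eqz_nat -?lt0n //.
by rewrite -addnBAC // divnDMl.
Qed.

(** * Reduction modulo powers of p *)

Lemma Zp_intr_mod n (z : int) : (1 < n)%N ->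
  (z %% n)%Z%:~R = z%:~R :> 'Z_n.
Proof.
move=> n_gt1; rewrite [in RHS](divz_eq z n) [RHS]rmorphD rmorphM /=.
have -> : (n%:Z)%:~R = 0 :> 'Z_n by apply: pchar_Zp.
by rewrite mulr0 add0r.
Qed.

Lemma Zp_natr_eq0 n m : (1 < n)%N -> (m%:R == 0 :> 'Z_n) = (n %| m)%N.
Proof. by move=> n_gt1; rewrite -val_eqE /= val_Zp_nat. Qed.

Lemma Zp_intr_eq0 n (z : int) : (1 < n)%N -> (z%:~R == 0 :> 'Z_n) = (n %| z)%Z.
Proof.
move=> n_gt1; have n_gt0 : 0 < n%:Z by rewrite ltz_nat ltnW.
rewrite -Zp_intr_mod // (sameP dvdz_mod0P eqP).
move: (modz_ge0 z (lt0r_neq0 n_gt0)) (ltz_pmod z n_gt0).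
case: (z %% n)%Z => // -[|k] _ kn; first by rewrite !eqxx.
by rewrite -[_%:~R]/(k.+1%:R) Zp_natr_eq0 // gtnNdvd.
Qed.

(* The side conditions are arguments to make morphism instances inferable. *)
Definition Zp_cast_mod m n of (1 < m)%N & (1 < n)%N & (n %| m)%N :
  'Z_m -> 'Z_n := fun z => (z : nat)%:R.

Section ZpCastMod.
Context (m n : nat) (m_gt1 : (1 < m)%N) (n_gt1 : (1 < n)%N) (nm : (n %| m)%N).
Local Notation f := (Zp_cast_mod m_gt1 n_gt1 nm).

Lemma Zp_cast_mod_nat k : f k%:R = k%:R.
Proof.
rewrite /Zp_cast_mod val_Zp_nat // -[LHS]Zp_nat_mod // -[RHS]Zp_nat_mod //.
by rewrite modn_dvdm.
Qed.

Lemma Zp_cast_mod_is_nmod_morphism : nmod_morphism f.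
Proof.
split=> [|x y]; first exact: (Zp_cast_mod_nat 0).
by rewrite -(natr_Zp x) -(natr_Zp y) -natrD !Zp_cast_mod_nat natrD.
Qed.

Lemma Zp_cast_mod_is_monoid_morphism : monoid_morphism f.
Proof.
split=> [|x y]; first exact: (Zp_cast_mod_nat 1).
by rewrite -(natr_Zp x) -(natr_Zp y) -natrM !Zp_cast_mod_nat natrM.
Qed.

HB.instance Definition _ := GRing.isNmodMorphism.Build _ _ f
  Zp_cast_mod_is_nmod_morphism.
HB.instance Definition _ := GRing.isMonoidMorphism.Build _ _ f
  Zp_cast_mod_is_monoid_morphism.
End ZpCastMod.

Lemma Zp_morph_eq0 m n (f : {rmorphism 'Z_m -> 'Z_n}) z : (1 < n)%N ->
  f z = 0 -> z = n%:R * (z %/ n)%N%:R.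
Proof.
move=> n_gt1; rewrite -{1}[z]natr_Zp rmorph_nat => /eqP.
by rewrite Zp_natr_eq0 // => nz; rewrite -natrM mulnC divnK // natr_Zp.
Qed.

(** A ring morphism maps k%:R to k%:R, so its kernel consists of multiples of n; dividing
    representatives by n gives E. *)
Lemma lmap_morph_eq m n (f : {rmorphism 'Z_m -> 'Z_n}) (X Y : laurent 'Z_m) :
    (1 < n)%N ->
  lmap f X = lmap f Y -> exists E, X = Y + n%:R * E.
Proof.
move=> n_gt1 fXY; exists (lmap (fun z : 'Z_m => (z %/ n)%N%:R) (X - Y)).
apply/malgP => k; rewrite mcoeffD mcoeffMnat lmapE; last by rewrite div0n.
rewrite -(@Zp_morph_eq0 _ _ f) // ?mcoeffB; first by rewrite addrC subrK.
by rewrite rmorphB -!(lmapE _ _ (rmorph0 f)) fXY subrr.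
Qed.

Lemma laurent_Zp_natr0 n : (1 < n)%N -> n%:R = 0 :> laurent 'Z_n.
Proof.
move=> n_gt1; apply/malgP => k.
by rewrite mcoeffMn -mulr_natl pchar_Zp // mul0r mcoeff0.
Qed.

Lemma laurent_pchar (R : nzRingType) : [pchar laurent R] =i [pchar R].
Proof.
move=> p; rewrite !inE; congr (_ && _); apply/eqP/eqP => p0; last first.
  by apply/malgP => k; rewrite mcoeffMn -mulr_natl p0 mul0r mcoeff0.
have /malgP/(_ (0%N, 0)) := p0.
by rewrite mcoeffMn mcoeffUU mcoeff0.
Qed.

Lemma pchar_expr_sum p (R : comNzRingType) I (s : seq I) (F : I -> R) :
  p \in [pchar R] -> (\sum_(i <- s) F i) ^+ p = \sum_(i <- s) F i ^+ p.
Proof. by move=> chp; apply: (rmorph_sum (pFrobenius_aut chp)). Qed.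

(** In characteristic p the p-th power is additive, and here it fixes the coefficients, so it acts
    on exponents alone. *)
Lemma lmap_expp p (R R' : comNzRingType) (f : {rmorphism R -> R'})
    (S : laurent R) :
    p \in [pchar R'] -> (forall c, f c ^+ p = f c) ->
  lmap f (S ^+ p) = lmap f (subst_pow p S).
Proof.
rewrite -laurent_pchar => chp fp.
rewrite rmorphXn /= [in LHS](monalgE S) /subst_pow !lmap_sum.
rewrite pchar_expr_sum //; apply: eq_bigr => k _.
by rewrite !lmapU ?rmorph0 // monalgU_exp fp.
Qed.

Lemma Zp_expp p (c : 'Z_p) : prime p -> c ^+ p = c.
Proof.
move=> p_pr; have chp : p \in [pchar 'Z_p].
  by rewrite inE p_pr /= pchar_Zp ?prime_gt1.
by rewrite -[c]natr_Zp -(pFrobenius_autE chp) pFrobenius_aut_nat.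
Qed.

(** X^p - Y^p is X - Y times a sum of p products X^(p-1-i) Y^i. Each is Y^(p-1) modulo p, so the sum
    contributes one more factor p. *)
Lemma exprp_cong (R : comNzRingType) p j (X Y E : R) :
    X = Y + p%:R ^+ j.+1 * E ->
  exists E', X ^+ p = Y ^+ p + p%:R ^+ j.+2 * E'.
Proof.
move=> XY; have dXY : X - Y = p%:R ^+ j.+1 * E by rewrite XY addrC addKr.
(* [F n] plays the role of (X^n - Y^n) / p. *)
pose F n := p%:R ^+ j * E * \sum_(i < n) X ^+ (n.-1 - i) * Y ^+ i.
have XF n : X ^+ n = Y ^+ n + p%:R * F n.
  by rewrite /F !mulrA -exprS -dXY -subrXX addrC subrK.
exists (E * (Y ^+ p.-1 + \sum_(i < p) F (p.-1 - i)%N * Y ^+ i)).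
rewrite -[LHS](subrK (Y ^+ p)) addrC subrXX dXY [in RHS]exprSr -!mulrA.
congr (_ + _ * _).
rewrite [RHS]mulrCA; congr (_ * _).
transitivity (\sum_(i < p) (Y ^+ p.-1 + p%:R * (F (p.-1 - i)%N * Y ^+ i))).
  apply: eq_bigr => i _; rewrite XF mulrDl -exprD mulrA subnK //.
  by rewrite -ltnS prednK // (leq_ltn_trans _ (ltn_ord i)).
by rewrite big_split /= sumr_const card_ord -mulr_sumr mulrDr -[_ *+ p]mulr_natl.
Qed.

Lemma expr_expn_cong (R : comNzRingType) p n (X Y E : R) :
    X = Y + p%:R * E ->
  exists E', X ^+ (p ^ n) = Y ^+ (p ^ n) + p%:R ^+ n.+1 * E'.
Proof.
move=> XY; elim: n => [|n [E' XYn]]; first by exists E; rewrite !expr1.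
have [E'' eqE] := exprp_cong XYn.
by exists E''; rewrite expnSr !exprM.
Qed.

(** * Expansions in p / Q *)

(* Formally, X / V^m is a polynomial of degree < g in a / V. *)
Definition padic_span (R : comNzRingType) (a V : R) g m (X : R) : Prop :=
  exists T : nat -> R, X = \sum_(k < g) T k * a ^+ k * V ^+ (m - k).

Section PadicSpan.
Context (R : comNzRingType) (a V : R) (g m : nat).
Local Notation span := (padic_span a V g m).

Lemma padic_span0 : span 0.
Proof.
by exists (fun=> 0); rewrite big1 // => k _; rewrite !mul0r.
Qed.

Lemma padic_spanD X Y : span X -> span Y -> span (X + Y).
Proof.
case=> T -> [U ->]; exists (fun k => T k + U k); rewrite -big_split.
by apply: eq_bigr => k _; rewrite !mulrDl.
Qed.

Lemma padic_spanM A X : span X -> span (A * X).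
Proof.
case=> T ->; exists (fun k => A * T k); rewrite mulr_sumr.
by apply: eq_bigr => k _; rewrite !mulrA.
Qed.

Lemma padic_span_sum I (s : seq I) (P : pred I) F :
  (forall i, P i -> span (F i)) -> span (\sum_(i <- s | P i) F i).
Proof. by apply: big_ind; [exact: padic_span0 | exact: padic_spanD]. Qed.

Lemma padic_span_gen j : a ^+ g = 0 -> span (a ^+ j * V ^+ (m - j)).
Proof.
move=> ag0; have [jg|gj] := ltnP j g; last first.
  by rewrite -(subnKC gj) exprD ag0 !mul0r; exact: padic_span0.
exists (fun k => (k == j)%:R); rewrite (bigD1 (Ordinal jg)) //= eqxx mul1r.
rewrite big1 ?addr0 // => k kj; rewrite -val_eqE /= in kj.
by rewrite (negbTE kj) !mul0r.
Qed.

(** In the binomial expansion every factor a E replaces one factor V, so the powers of a and V stay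
    matched; terms with a^g or more vanish. *)
Lemma padic_span_exp E k : a ^+ g = 0 ->
  span (a ^+ k * (V + a * E) ^+ (m - k)).
Proof.
move=> ag0; rewrite exprDn mulr_sumr; apply: padic_span_sum => i _.
rewrite exprMn mulrnAr -mulr_natl.
rewrite [X in span X](_ : _ = ('C(m - k, i)%:R * E ^+ i) *
  (a ^+ (k + i) * V ^+ (m - (k + i)))); last by rewrite exprD subnDA; ring.
by apply: padic_spanM; apply: padic_span_gen.
Qed.

End PadicSpan.

(** * Reduction of p-adic integers modulo p^g *)

(** At g = 0 the reduction is not a ring morphism; taking positivity as an argument lets the
    morphism instances be inferred. *)
Definition padic_redm p (p_pr : prime p) g of (0 < g)%N :
  padic p_pr -> 'Z_(p ^ g) := padic_red g.

Section PadicReduction.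
Context (p : nat) (p_pr : prime p).

Lemma pexp_gt1 g : (0 < g)%N -> (1 < p ^ g)%N.
Proof. by move=> g_gt0; rewrite -(expn0 p) ltn_exp2l ?prime_gt1. Qed.

Section Morphism.
Context (g : nat) (g_gt0 : (0 < g)%N).
Local Notation red := (@padic_redm p p_pr g g_gt0).

Lemma padic_redm_is_nmod_morphism : nmod_morphism red.
Proof.
have pg := pexp_gt1 g_gt0.
split=> [|x y]; rewrite /padic_redm /padic_red /= Zp_intr_mod //.
exact: rmorphD.
Qed.

Lemma padic_redm_is_monoid_morphism : monoid_morphism red.
Proof.
have pg := pexp_gt1 g_gt0.
split=> [|x y]; rewrite /padic_redm /padic_red /= Zp_intr_mod //.
exact: rmorphM.
Qed.

HB.instance Definition _ := GRing.isNmodMorphism.Build _ _ red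
  padic_redm_is_nmod_morphism.
HB.instance Definition _ := GRing.isMonoidMorphism.Build _ _ red
  padic_redm_is_monoid_morphism.

Lemma lredE (S : laurent (padic p_pr)) : lred g S = lmap red S.
Proof. by []. Qed.

Lemma mcoeff_lred (S : laurent (padic p_pr)) k :
  (lred g S)@_k = padic_red g S@_k.
Proof. by rewrite lredE lmapE // rmorph0. Qed.

End Morphism.

Lemma padic_mod_le (x : padic p_pr) a b : (b <= a)%N ->
  (x a = x b %[mod (p ^ b)%N])%Z.
Proof.
move=> ba; rewrite -(subnK ba); elim: (a - b)%N => [|n IHn] //.
rewrite -IHn addSn; apply/esym/eqP; rewrite eqz_mod_dvd.
apply: (@dvdz_trans (p ^ (n + b))%N%:Z).
  by rewrite expnD PoszM dvdz_mull.
by rewrite -eqz_mod_dvd; apply/eqP/padic_succ.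
Qed.

Lemma padic_red_cast a b (f : {rmorphism 'Z_(p ^ a) -> 'Z_(p ^ b)}) x :
  (0 < b <= a)%N -> f (@padic_red p p_pr a x) = padic_red b x.
Proof.
case/andP=> b_gt0 ba; have pb := pexp_gt1 b_gt0.
by rewrite rmorph_int -Zp_intr_mod // (padic_mod_le x ba) Zp_intr_mod.
Qed.

Lemma lmap_lred a b (f : {rmorphism 'Z_(p ^ a) -> 'Z_(p ^ b)}) S :
  (0 < b <= a)%N -> lmap f (@lred p p_pr a S) = lred b S.
Proof.
case/andP=> b_gt0 ba; have a_gt0 := leq_trans b_gt0 ba.
apply/malgP => k; rewrite lmapE ?rmorph0 // !mcoeff_lred //.
by rewrite padic_red_cast // b_gt0.
Qed.

End PadicReduction.


(** * Coefficients of polynomials, and Cartier operators on expansions *)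

Lemma mcoeff_laurent_of_poly (R : nzRingType) (P : {poly {poly R}}) i n :
  (laurent_of_poly P)@_(i, n) = if n is Posz j then P`_j`_i else 0.
Proof.
rewrite /laurent_of_poly mcoeff_bigsum.
have H (q : {poly R}) j : (\sum_(k < size q) q`_k *: lmonom R k j)@_(i, n) =
    q`_i *+ (j == n).
  rewrite mcoeff_bigsum.
  transitivity (\sum_(k < size q | k == i :> nat) q`_k *+ (j == n)).
    rewrite [RHS]big_mkcond; apply: eq_bigr => k _.
    rewrite mcoeffZ mcoeffU xpair_eqE mulr_natr.
    by case: (k == i :> nat).
  have [iq|qi] := ltnP i (size q).
    by rewrite (big_pred1 (Ordinal iq)).
  rewrite nth_default // mul0rn big1 // => k /eqP ki.
  by move: (ltn_ord k); rewrite ki ltnNge qi.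
under eq_bigr do rewrite H.
case: n {H} => j; last by rewrite big1 // => k _; rewrite mulr0n.
have [jP|Pj] := ltnP j (size P).
  rewrite (bigD1 (Ordinal jP)) //= eqxx big1 ?addr0 // => k kj.
  rewrite -val_eqE /= in kj.
  by rewrite eqz_nat (negbTE kj).
rewrite (nth_default _ Pj) coef0 big1 // => k _.
by rewrite eqz_nat ltn_eqF // (leq_trans (ltn_ord k)).
Qed.

Lemma cartier_natM p (R : nzRingType) r n (S : laurent R) : (r < p)%N ->
  cartier p r (n%:R * S) = n%:R * cartier p r S.
Proof.
move=> rp; apply/malgP => -[a b].
by rewrite mcoeffMnat !mcoeff_cartier // mcoeffMnat.
Qed.

Lemma cartier_mul_subst_exp p (R : comNzRingType) r (A B : laurent R) n :
  (r < p)%N -> cartier p r (A * subst_pow p B ^+ n) = cartier p r A * B ^+ n.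
Proof.
move=> rp; elim: n => [|n IHn]; first by rewrite !expr0 !mulr1.
by rewrite !exprSr !mulrA cartier_mul_subst // IHn.
Qed.

Lemma cartier_padic_span p (R : comNzRingType) r g m (Q S : laurent R) :
    (r < p)%N ->
  padic_span p%:R (subst_pow p Q) g m S -> padic_span p%:R Q g m (cartier p r S).
Proof.
move=> rp [T ->]; exists (fun k => cartier p r (T k)).
rewrite cartier_sum //; apply: eq_bigr => k _.
rewrite cartier_mul_subst_exp //; congr (_ * _).
by rewrite -natrX mulrC cartier_natM // mulrC.
Qed.

Lemma lredM p (p_pr : prime p) g (S T : laurent (padic p_pr)) : (0 < g)%N ->
  lred g (S * T) = lred g S * lred g T.
Proof. by move=> g_gt0; rewrite !(lredE g_gt0) rmorphM. Qed.

Lemma lredX p (p_pr : prime p) g (S : laurent (padic p_pr)) n : (0 < g)%N ->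
  lred g (S ^+ n) = lred g S ^+ n.
Proof. by move=> g_gt0; rewrite !(lredE g_gt0) rmorphXn. Qed.

(** * Existence and uniqueness of digit expansions *)

Section Expansion.
Context (R : comNzRingType) (I : Type) (digit : I -> Prop) (phi : I -> R).
Context (a V : R) (g m : nat) (ag0 : a ^+ g = 0).

(* Carries are pushed upwards until [a ^+ g = 0] kills them. *)
Lemma padic_span_expansion S :
    (g <= m.+1)%N ->
    (forall A, exists i B, digit i /\ A = phi i + a * B) ->
    padic_span a V g m S ->
  exists T : nat -> I, (forall k, digit (T k)) /\
    S = \sum_(k < g) phi (T k) * a ^+ k * V ^+ (m - k).
Proof.
move=> gm decomp [T ->].
(* [B] is the pending carry out of place n - 1. As n <= m, its power of V is one more than that of
   place n, whence [B * V + T n] is what gets split next. *)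
have carry n : (n <= m.+1)%N -> exists (D : nat -> I) B, (forall k, digit (D k)) /\
    \sum_(k < n) T k * a ^+ k * V ^+ (m - k) =
    \sum_(k < n) phi (D k) * a ^+ k * V ^+ (m - k) + B * a ^+ n * V ^+ (m.+1 - n).
  elim: n => [_|n IHn nm].
    have [i [_ [di _]]] := decomp 0.
    by exists (fun=> i), 0; split=> //; rewrite !big_ord0 !mul0r addr0.
  have [D [B [Ddig eqD]]] := IHn (ltnW nm).
  have [d [B' [ddig eqd]]] := decomp (B * V + T n).
  exists (fun k => if (k < n)%N then D k else d), B'.
  split=> [k|]; first by case: ifP.
  rewrite !big_ord_recr /= eqD ltnn subSS -!addrA.
  congr (_ + _); first by apply: eq_bigr => k _; rewrite ltn_ord.
  rewrite subSn // !exprS.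
  transitivity ((B * V + T n) * a ^+ n * V ^+ (m - n)); first by ring.
  by rewrite eqd; ring.
have [D [B [Ddig ->]]] := carry g gm.
by exists D; split=> //; rewrite ag0 mulr0 mul0r addr0.
Qed.

(** Strong induction on k: multiplied by a^(g-1-k), the difference loses its terms above k because
    a^g = 0, and those below k vanish by induction. What remains is the k-th difference times
    a^(g-1) and a cancellable power of V. *)
Lemma expansion_unique (T T' : 'I_g -> I) :
    GRing.lreg V ->
    (forall i j, digit i -> digit j -> a ^+ (g - 1) * (phi i - phi j) = 0 -> i = j) ->
    (forall k, digit (T k)) -> (forall k, digit (T' k)) ->
    \sum_(k < g) phi (T k) * a ^+ k * V ^+ (m - k)
      = \sum_(k < g) phi (T' k) * a ^+ k * V ^+ (m - k) ->
  T =1 T'.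
Proof.
move=> Vreg inj Td T'd eqTT'.
have diff0 : \sum_(k < g) (phi (T k) - phi (T' k)) * a ^+ k * V ^+ (m - k) = 0.
  rewrite -[RHS](subrr (\sum_(k < g) phi (T' k) * a ^+ k * V ^+ (m - k))).
  rewrite -{1}eqTT' -sumrB.
  by apply: eq_bigr => k _; rewrite !mulrBl.
move=> k; have [n] := ubnP (k : nat); elim: n k => // n IHn k kn.
apply: inj => //; apply: (lregX (n := m - k) Vreg).
have := congr1 (fun A => a ^+ (g - 1 - k) * A) diff0.
have kg : (k <= g - 1)%N by rewrite -ltnS subn1 prednK // (leq_ltn_trans _ (ltn_ord k)).
rewrite !mulr0 mulr_sumr (bigD1 k) //= big1 ?addr0 => [<-|j jk].
  by rewrite -{1}(subnK kg) exprD; ring.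
have [jltk|] := ltnP j k.
  by rewrite IHn ?subrr ?mul0r ?mulr0 // (leq_trans jltk).
rewrite leq_eqVlt eq_sym [X in X || _](negbTE jk) /= => kltj.
transitivity (a ^+ (g - 1 - k + j) * ((phi (T j) - phi (T' j)) * V ^+ (m - j))).
  by rewrite exprD; ring.
have -> : (g - 1 - k + j = g + (j - k.+1))%N by move: (ltn_ord j); lia.
by rewrite exprD ag0 !mul0r.
Qed.

End Expansion.

Section Digits.
Context (p : nat) (p_pr : prime p) (g : nat) (g_gt0 : (0 < g)%N).
Local Notation L := (laurent 'Z_(p ^ g)).

Lemma laurent_pX0 : p%:R ^+ g = 0 :> L.
Proof. by rewrite -natrX laurent_Zp_natr0 // pexp_gt1. Qed.

(** Euclidean division by p of the representatives of the coefficients. *)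
Lemma digit_decomp (A : L) : exists D R,
  digit_poly p D /\ A = lmap intr D + p%:R * R.
Proof.
have p_gt0 := prime_gt0 p_pr.
pose d (z : 'Z_(p ^ g)) := (z %% p)%N%:Z.
pose q (z : 'Z_(p ^ g)) : 'Z_(p ^ g) := (z %/ p)%N%:R.
have d0 : d 0 = 0 by rewrite /d mod0n.
have q0 : q 0 = 0 by rewrite /q div0n.
exists (lmap d A), (lmap q A); split=> [k|].
  by rewrite lmapE // /d ltz_nat ltn_mod p_gt0.
apply/malgP => k; rewrite mcoeffD mcoeffMnat !lmapE //.
rewrite /d /q -[(_ %% _)%N%:Z%:~R]/((_ %% _)%N%:R) -natrM -natrD addnC mulnC.
by rewrite -divn_eq natr_Zp.
Qed.

(** Modulo p^g the hypothesis says that p divides each difference of coefficients, which is less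
    than p in absolute value. *)
Lemma digit_unique (D D' : laurent int) : digit_poly p D -> digit_poly p D' ->
  p%:R ^+ (g - 1) * (lmap intr D - lmap intr D') = 0 :> L -> D = D'.
Proof.
move=> Ddig D'dig /malgP eq0; apply/malgP => k; move: (eq0 k) (Ddig k) (D'dig k).
rewrite -natrX mcoeffMnat mcoeffB !lmapE ?mulr0z // mcoeff0.
rewrite -rmorphB -[(p ^ _)%:R]/((p ^ (g - 1))%N%:Z%:~R) -rmorphM => /eqP.
rewrite Zp_intr_eq0 ?pexp_gt1 //.
have -> : (p ^ g = p ^ (g - 1) * p)%N by rewrite -expnSr subn1 prednK.
rewrite PoszM dvdz_mul2l ?eqz_nat -?lt0n ?expn_gt0 ?prime_gt0 // => /dvdzP[c].
move: D@_k D'@_k => x y exy /andP[x0 xp] /andP[y0 yp].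
have [|[|]] : c <= -1 \/ c = 0 \/ 1 <= c by lia.
all: nia.
Qed.

End Digits.

(** Ensures that the exponents p^(g-1) - 1 - k with k < g are true differences. *)
Lemma leq_expn_pred p g : (1 < p)%N -> (0 < g)%N ->
  (g <= (p ^ (g - 1) - 1).+1)%N.
Proof.
move=> p_gt1; case: g => // g _; rewrite !subn1 prednK ?expn_gt0 ?(ltnW p_gt1) //.
exact: ltn_expl.
Qed.

Lemma expr_regroup (R : comNzRingType) (t a q : R) p n1 n2 n3 n4 :
    (n1 + n2 = n3 + p * n4)%N ->
  t * a * q ^+ n1 * q ^+ n2 = t * q ^+ n3 * (a * (q ^+ p) ^+ n4).
Proof.
by move=> e; rewrite -mulrA -exprD e exprD exprM mulrACA.
Qed.

Lemma expr_regroup_outer (R : comNzRingType) (t q : R) n1 n2 n3 n4 n5 :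
    (n1 + n2 = n3 + n4 * n5)%N ->
  q ^+ n1 * t * q ^+ n2 = t * q ^+ n3 * (q ^+ n4) ^+ n5.
Proof.
by move=> e; rewrite -mulrA mulrCA -exprD e exprD exprM mulrA.
Qed.

(** * The operator lambda at a fixed level *)

Section Level.
Context (p : nat) (p_pr : prime p) (Q : laurent (padic p_pr)).
Context (g : nat) (g_gt0 : (0 < g)%N).
Local Notation Qg := (lred g Q).
Local Notation m := (p ^ (g - 1) - 1)%N.

Let pg_gt1 : (1 < p ^ g)%N := pexp_gt1 p_pr g_gt0.

Let pX0 : p%:R ^+ g = 0 :> laurent 'Z_(p ^ g) := laurent_pX0 p_pr g_gt0.

Let level_le : (g <= m.+1)%N := leq_expn_pred (prime_gt1 p_pr) g_gt0.

Let red1 : {rmorphism 'Z_(p ^ g) -> 'Z_(p ^ 1)} :=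
  Zp_cast_mod pg_gt1 (pexp_gt1 p_pr (ltn0Sn 0)) (dvdn_exp2l p g_gt0).

Lemma lred_expp_cong : exists E, Qg ^+ p = subst_pow p Qg + p%:R * E.
Proof.
have [||E] := @lmap_morph_eq _ _ red1 (Qg ^+ p) (subst_pow p Qg).
- by rewrite expn1 prime_gt1.
- apply: lmap_expp => [|c]; last exact: Zp_expp.
  by rewrite inE p_pr /= pchar_Zp // expn1 prime_gt1.
by rewrite expn1 => ->; exists E.
Qed.

(** With N = p^(g-1), the k-th term carries Q to the power (N-1-k) + (pN-N) = (p-1)(k+1) + p(N-1-k).
    Expanding the last part as (F + p E)^(N-1-k) gives a combination of the p^j F^(m-j), which the
    Cartier operator sends to one of the p^j Q^(m-j). *)
Lemma lambda_span (r : 'I_p) S :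
  padic_span p%:R Qg g m S -> padic_span p%:R Qg g m (lambda Q g r S).
Proof.
case=> T ->; apply: cartier_padic_span => //; rewrite mulr_suml.
have [E eqE] := lred_expp_cong.
apply: padic_span_sum => k _.
rewrite [X in padic_span _ _ _ _ X](_ : _ = T k * Qg ^+ (p.-1 * k.+1) *
  (p%:R ^+ k * (subst_pow p Qg + p%:R * E) ^+ (m - k))).
  by apply: padic_spanM; apply: padic_span_exp.
rewrite -eqE; apply: expr_regroup.
have kN : (k < p ^ (g - 1))%N.
  by rewrite (leq_trans (ltn_ord k)) // (leq_trans level_le) // subn1 prednK
             // expn_gt0 prime_gt0.
have -> : (p ^ g = p * p ^ (g - 1))%N by rewrite -expnS subn1 prednK.
move: (p ^ (g - 1))%N kN (prime_gt0 p_pr) => N kN p_gt0.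
rewrite -(subnKC kN); move: (N - k.+1)%N => d.
have -> : (k.+1 + d - 1 - k = d)%N by lia.
by move: (p) p_gt0 => [//|q] _ /=; rewrite mulSn addKn; nia.
Qed.

Lemma is_rep_unique (S : laurent 'Z_(p ^ g)) T T' :
  GRing.lreg Qg -> is_rep Q S T -> is_rep Q S T' -> T =1 T'.
Proof.
move=> Qreg [Td ST] [T'd ST'].
have dig_uniq D D' := @digit_unique _ p_pr _ g_gt0 D D'.
have eqTT' := etrans (esym ST) ST'.
exact: (expansion_unique pX0 Qreg dig_uniq Td T'd eqTT').
Qed.

End Level.

(** * Comparison of the levels alpha and beta *)

Section Truncate.
Context (p : nat) (p_pr : prime p) (Q : laurent (padic p_pr)).
Context (alpha beta : nat) (beta_gt0 : (0 < beta)%N) (ba : (beta <= alpha)%N).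
Let alpha_gt0 : (0 < alpha)%N := leq_trans beta_gt0 ba.
Let red : {rmorphism 'Z_(p ^ alpha) -> 'Z_(p ^ beta)} :=
  Zp_cast_mod (pexp_gt1 p_pr alpha_gt0) (pexp_gt1 p_pr beta_gt0)
    (dvdn_exp2l p ba).
Local Notation shift := (p ^ (alpha - 1) - p ^ (beta - 1))%N.

(* The digits T_k with k >= beta die modulo p^beta. *)
Lemma truncate_rep S T : is_rep Q S T ->
  lmap red S = lred beta Q ^+ shift *
    \sum_(k < beta) lmap intr (T (widen_ord ba k)) * p%:R ^+ k
      * lred beta Q ^+ (p ^ (beta - 1) - 1 - k).
Proof.
case=> _ ->; rewrite raddf_sum mulr_sumr /=.
transitivity (\sum_(k < alpha | (k < beta)%N)
    lmap intr (T k) * p%:R ^+ k * lred beta Q ^+ (p ^ (alpha - 1) - 1 - k)).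
  rewrite [RHS]big_mkcond; apply: eq_bigr => k _.
  rewrite !rmorphM !rmorphXn rmorph_nat /= lmap_lred ?beta_gt0 //.
  rewrite (lmap_comp _ (h := intr)) ?rmorph0 // => [|c]; last exact: rmorph_int.
  by case: ltnP => // bk; rewrite -{1}(subnKC bk) exprD laurent_pX0 // !(mul0r, mulr0).
rewrite big_ord_narrow; apply: eq_bigr => k _; rewrite mulrCA -exprD /=.
congr (_ * _ ^+ _).
have := leq_pexp2l (prime_gt0 p_pr) (leq_sub2r 1 ba).
have := leq_expn_pred (prime_gt1 p_pr) beta_gt0.
have : (0 < p ^ (beta - 1))%N by rewrite expn_gt0 prime_gt0.
have := ltn_ord k; lia.
Qed.

(** The exponents satisfy [shift] + (p^alpha - p^(alpha-1)) = (p^beta - p^(beta-1)) + p^beta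
    (p^(alpha-beta) - 1). Modulo p^beta the last part of the power of Q is F^[shift], which leaves
    the Cartier operator as Q^[shift]. *)
Lemma lambda_truncate (r : 'I_p) Sa Sb :
  lmap red Sa = lred beta Q ^+ shift * Sb ->
  lmap red (lambda Q alpha r Sa) = lred beta Q ^+ shift * lambda Q beta r Sb.
Proof.
move=> SaSb; have [E eqE] := lred_expp_cong Q beta_gt0.
have frob : lred beta Q ^+ (p ^ beta) = subst_pow p (lred beta Q) ^+ (p ^ (beta - 1)).
  have [E'] := expr_expn_cong (beta - 1) eqE.
  have -> : (beta - 1).+1 = beta by rewrite subn1 prednK.
  by rewrite laurent_pX0 // mul0r addr0 -exprM -expnS subn1 prednK.
have shiftE : shift = (p ^ (beta - 1) * (p ^ (alpha - beta) - 1))%N.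
  by rewrite mulnBr muln1 -expnD; congr (p ^ _ - _)%N; lia.
have redQ : lmap red (lred alpha Q) = lred beta Q.
  by apply: lmap_lred; rewrite beta_gt0.
rewrite /lambda (cartier_lmap _ _ (ltn_ord r)) rmorphM rmorphXn /= redQ SaSb.
rewrite [RHS]mulrC -(cartier_mul_subst_exp _ _ _ (ltn_ord r)).
rewrite [in RHS]shiftE [in RHS]exprM -frob.
congr cartier; apply: expr_regroup_outer.
rewrite mulnBr muln1 -expnD subnKC //.
have := leq_pexp2l (prime_gt0 p_pr) (leq_sub2r 1 ba).
have := leq_pexp2l (prime_gt0 p_pr) ba.
have := leq_pexp2l (prime_gt0 p_pr) (leq_subr 1 beta).
have := leq_pexp2l (prime_gt0 p_pr) (leq_subr 1 alpha).
move: (p ^ alpha)%N (p ^ (alpha - 1))%N (p ^ beta)%N (p ^ (beta - 1))%N.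
by move=> a a' b b'; clear; lia.
Qed.

End Truncate.

(** * Lifts of P / y and the digits of states *)

Section Lift.
Context (p : nat) (p_pr : prime p).
Context (P : {poly {poly padic p_pr}}) (Q : laurent (padic p_pr)).
Context (QP : is_lift Q P).

Lemma mcoeff_div_y i (n : int) :
  (div_y P)@_(i, n) = if n + 1 is Posz j then P`_j`_i else 0.
Proof. by rewrite mcoeff_lmonomM opprK mcoeff_laurent_of_poly. Qed.

Context (g : nat) (g_gt0 : (0 < g)%N).
Local Notation Qg := (lred g Q).
Local Notation m := (p ^ (g - 1) - 1)%N.

Let pg_gt1 : (1 < p ^ g)%N := pexp_gt1 p_pr g_gt0.

Let pX0 : p%:R ^+ g = 0 :> laurent 'Z_(p ^ g) := laurent_pX0 p_pr g_gt0.

Let level_le : (g <= m.+1)%N := leq_expn_pred (prime_gt1 p_pr) g_gt0.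

Let red1 : {rmorphism 'Z_(p ^ g) -> 'Z_(p ^ 1)} :=
  Zp_cast_mod pg_gt1 (pexp_gt1 p_pr (ltn0Sn 0)) (dvdn_exp2l p g_gt0).

(** Modulo p the constant coefficient of Q is dP/dy(0, 0), hence a unit modulo p^g. The coefficient
    of y^(-1) in P / y is P(0, 0) = 0, and equality of supports makes the corresponding coefficient
    of Q vanish exactly, not just modulo p. *)
Lemma lift_lreg : P.[0].[0] = 0 -> padic_red 1 P^`().[0].[0] != 0 ->
  GRing.lreg Qg.
Proof.
move=> P00 dP00; case: QP => Q1 Qsupp; apply: laurent_unit0_lreg => [|n n_lt0].
  have: (lred 1 Q)@_(0%N, 0) != 0.
    rewrite Q1 mcoeff_lred // mcoeff_div_y /=.
    by move: dP00; rewrite !horner_coef0 coef_deriv mulr1n.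
  rewrite -(@lmap_lred _ _ _ _ red1) ?g_gt0 // lmapE ?rmorph0 //.
  rewrite -[X in red1 X]natr_Zp rmorph_nat Zp_natr_eq0 expn1 ?prime_gt1 //.
  by rewrite -[Qg@_ _]natr_Zp unitZpE // coprime_pexpl // prime_coprime // natr_Zp.
rewrite mcoeff_lred //.
suff -> : Q@_(0%N, n) = 0 by apply: (rmorph0 (padic_redm g_gt0)).
apply: mcoeff_outdom; rewrite Qsupp -mcoeff_eq0 mcoeff_lred // mcoeff_div_y.
suff -> : (if n + 1 is Posz j then P`_j`_0 else 0) = 0.
  by apply/eqP/(rmorph0 (padic_redm (ltn0Sn 0))).
case: n n_lt0 => // -[|n] _ //.
by move: P00; rewrite !horner_coef0.
Qed.

Lemma lred_div_y_cong : exists E, lred g (div_y P) = Qg + p%:R * E.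
Proof.
have [||E] := @lmap_morph_eq _ _ red1 (lred g (div_y P)) Qg.
- by rewrite expn1 prime_gt1.
- by rewrite !lmap_lred ?g_gt0 //; case: QP => ->.
by rewrite expn1 => ->; exists E.
Qed.

Lemma init_state_span : padic_span p%:R Qg g m (init_state P g).
Proof.
have [E eqE] := lred_div_y_cong.
rewrite /init_state lredM // lredX // eqE.
apply: padic_spanM.
by have := padic_span_exp Qg m E 0 pX0; rewrite expr0 mul1r subn0.
Qed.

Lemma states_span S : states P Q g S -> padic_span p%:R Qg g m S.
Proof. by elim=> [|r S' _]; [exact: init_state_span | exact: lambda_span]. Qed.

(** Existence of an expansion rules out the default value in [rep]. *)
Lemma states_is_rep S : states P Q g S -> is_rep Q S (rep Q g S).
Proof.
move=> /states_span.
case/(padic_span_expansion pX0 level_le (digit_decomp p_pr (g := g))).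
move=> T [Tdig ST].
by apply: (@xgetPex _ _ [set T | is_rep Q S T]%classic); exists (fun k => T k).
Qed.

End Lift.

Theorem theorem20 (p : nat) (p_pr : prime p)
    (P : {poly {poly padic p_pr}}) (Q : laurent (padic p_pr))
    (P00 : P.[0].[0] = 0)
    (dP00 : padic_red 1 P^`().[0].[0] != 0)
    (QP : is_lift Q P)
    (alpha beta : nat) (beta_gt0 : (1 <= beta)%N)
    (le_beta_alpha : (beta <= alpha)%N) (r : 'I_p)
    (Sb : laurent 'Z_(p ^ beta)) (Sa : laurent 'Z_(p ^ alpha))
    (Sb_state : states P Q beta Sb) (Sa_state : states P Q alpha Sa)
    (agree : forall k : 'I_beta,
      rep Q alpha Sa (widen_ord le_beta_alpha k) = rep Q beta Sb k) :
  forall k : 'I_beta,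
    rep Q alpha (lambda Q alpha r Sa) (widen_ord le_beta_alpha k)
      = rep Q beta (lambda Q beta r Sb) k.
Proof.
have alpha_gt0 := leq_trans beta_gt0 le_beta_alpha.
have repa := states_is_rep QP alpha_gt0.
have rep_lama := repa _ (states_lambda r Sa_state).
have rep_lamb := states_is_rep QP beta_gt0 (states_lambda r Sb_state).
(* By uniqueness it suffices that the truncated digits represent the new state at level beta. *)
suff rep_trunc : is_rep Q (lambda Q beta r Sb)
    (fun k => rep Q alpha (lambda Q alpha r Sa) (widen_ord le_beta_alpha k)).
  exact: (is_rep_unique beta_gt0 (lift_lreg QP beta_gt0 P00 dP00) rep_trunc rep_lamb).
split=> [k|]; first by case: rep_lama.
(* Both sides may be multiplied by the power of Q by which the levels differ; each then equals the
   reduction of lambda(Sa) modulo p^beta. *)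
apply: (lregX (lift_lreg QP beta_gt0 P00 dP00)).
apply: etrans (truncate_rep beta_gt0 le_beta_alpha rep_lama).
apply/esym; apply: lambda_truncate.
rewrite (truncate_rep beta_gt0 le_beta_alpha (repa _ Sa_state)); congr (_ * _).
have [_ SbE] := states_is_rep QP beta_gt0 Sb_state; rewrite [RHS]SbE.
by apply: eq_bigr => k _; rewrite agree.
Qed.
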